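(* Let $\mathcal{P}_0\subset\mathcal{P}$. Suppose that for each $P\in\mathcal{P}_0$ there exist deterministic rate functions $g_P,h_P$ tending to zero as $n\to\infty$ and functions $\xi,\xi':[0,1]\times[0,1]^d\to\mathbb{R}$ such that (i) $\|F_{X\mid Z}-\hat F^{(n)}_{X\mid Z}\|_{\mathcal{T},\infty}\in\mathcal{O}_P(g_P(n))$ and $\|F_{Y\mid Z}-\hat F^{(n)}_{Y\mid Z}\|'_{\mathcal{T},\infty}\in\mathcal{O}_P(h_P(n))$; (ii) $\|\xi-\hat F^{(n)}_{X\mid Z}\|_{\mathcal{T}^c,\infty}\in\mathcal{O}_P(g_P(n))$ and $\|\xi'-\hat F^{(n)}_{Y\mid Z}\|'_{\mathcal{T}^c,\infty}\in\mathcal{O}_P(h_P(n))$. Then the statistic $\hat\rho_n=\frac1n\sum_{i=1}^n\phi(\hat U_{1,i})\phi(\hat U_{2,i})^T$ satisfies $\hat\rho_n\to\rho$ in $P$-probability for each fixed $P\in\mathcal{P}_0$, where $\rho=E_P(\phi(U_1)\phi(U_2)^T)$.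
   Context: $\mathcal{P}$ is the set of distributions of $(X,Y,Z)$ on $[0,1]^{2+d}$ ($X,Y\in[0,1]$, $Z\in[0,1]^d$) absolutely continuous with respect to Lebesgue measure. Throughout, for every $z$ the conditional distributions of $X$ and of $Y$ given $Z=z$ are continuous. $F_{X\mid Z}(t\mid z)=P(X\le t\mid Z=z)$ and $Q_{X\mid Z}(\tau\mid z)=\inf\{t\in[0,1]:F_{X\mid Z}(t\mid z)\ge\tau\}$; similarly for $Y$. $U_1=F_{X\mid Z}(X\mid Z)$, $U_2=F_{Y\mid Z}(Y\mid Z)$. $(X_i,Y_i,Z_i)_{i=1}^n$ is an i.i.d. sample from $P$. An estimator $\hat F^{(n)}_{X\mid Z}$ is a mapping from the sample $(X_i,Z_i)_{i=1}^n$ to functions $\hat F^{(n)}_{X\mid Z}(\cdot\mid z):[0,1]\to[0,1]$ that for every $z\in[0,1]^d$ are continuous and increasing with value $0$ at $0$ and $1$ at $1$; similarly $\hat F^{(n)}_{Y\mid Z}$ is such a mapping from $(Y_i,Z_i)_{i=1}^n$. Put $\hat U_{1,i}=\hat F^{(n)}_{X\mid Z}(X_i\mid Z_i)$ and $\hat U_{2,i}=\hat F^{(n)}_{Y\mid Z}(Y_i\mid Z_i)$. The function $\phi=(\phi_1,\dots,\phi_q):[0,1]\to\mathbb{R}^q$ satisfies: each $\phi_k$ has support $\mathcal{T}_k$ that is a compact subset of $(0,1)$; each $\phi_k$ is Lipschitz continuous; $\int_0^1\phi_k(u)\,\mathrm{d}u=0$ and $\int_0^1\phi_k(u)^2\,\mathrm{d}u=1$;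 $\phi_1,\dots,\phi_q$ are linearly independent. $\tau_{\min}=\inf(\mathcal{T}_1\cup\dots\cup\mathcal{T}_q)$, $\tau_{\max}=\sup(\mathcal{T}_1\cup\dots\cup\mathcal{T}_q)$, $\mathcal{T}=[\tau_{\min},\tau_{\max}]$. $\|f\|_{\mathcal{T},\infty}=\sup_{z\in[0,1]^d}\sup_{t\in Q_{X\mid Z}(\mathcal{T}\mid z)}|f(t,z)|$ with $Q_{X\mid Z}(\mathcal{T}\mid z)=[Q_{X\mid Z}(\tau_{\min}\mid z),Q_{X\mid Z}(\tau_{\max}\mid z)]$, and $\|f\|_{\mathcal{T}^c,\infty}$ is the same with the inner supremum over the complement $[0,1]\setminus Q_{X\mid Z}(\mathcal{T}\mid z)$. $\|\cdot\|'_{\mathcal{T},\infty}$ and $\|\cdot\|'_{\mathcal{T}^c,\infty}$ are defined in the same way with $Q_{Y\mid Z}$ in place of $Q_{X\mid Z}$. $X_n\in\mathcal{O}_P(a_n)$ (for a nonzero sequence $a_n$) means: for every $\epsilon>0$ there is $M>0$ with $\sup_nP(|X_n/a_n|>M)<\epsilon$. *)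

(* Defs.v *)
From mathcomp Require Import all_boot all_order all_algebra.
From mathcomp Require Import all_classical all_reals all_analysis.

Set Implicit Arguments.
Unset Strict Implicit.
Unset Printing Implicit Defensive.

Import Order.TTheory GRing.Theory Num.Theory.
Import numFieldNormedType.Exports.

Local Open Scope classical_set_scope.
Local Open Scope ring_scope.

(* An observation (x, y, z) is encoded as ((x, y), z).  Functions of "t given
   z" are defined on the whole of R and R^d, but they are only ever
   constrained and compared on [0,1] and [0,1]^d. *)
Notation obs R d := (R * R * d.-tuple R)%type.

Section Model.
Context {R : realType} {d : nat}.
Implicit Types (P : probability (obs R d) R) (z : d.-tuple R).

Definition obsX (w : obs R d) : R := w.1.1.
Definition obsY (w : obs R d) : R := w.1.2.
Definition obsZ (w : obs R d) : d.-tuple R := w.2.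

Definition cube : set (d.-tuple R) :=
  [set z | forall i, tnth z i \in `[0, 1]].

Definition obs_cube : set (obs R d) :=
  [set w | [/\ obsX w \in `[0, 1], obsY w \in `[0, 1] & cube (obsZ w)]].

End Model.

Fixpoint lebesgue_tuple (R : realType) (d : nat) :
    set (d.-tuple R) -> \bar R :=
  match d with
  | 0 => \d_[tuple]
  | d'.+1 => pushforward (@lebesgue_measure R \x @lebesgue_tuple R d')%E
               (fun p : R * d'.-tuple R => [tuple of p.1 :: p.2])
  end.

Definition lebesgue_obs (R : realType) (d : nat) : set (obs R d) -> \bar R :=
  ((@lebesgue_measure R \x @lebesgue_measure R) \x @lebesgue_tuple R d)%E.

Definition calP (R : realType) (d : nat) : set (probability (obs R d) R) :=
  [set P | P obs_cube = 1%E /\ P `<< @lebesgue_obs R d].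

Section Conditional.
Context {R : realType} {d : nat}.
Implicit Types (P : probability (obs R d) R) (z : d.-tuple R)
  (V : obs R d -> R) (k : R.-pker (d.-tuple R) ~> R).

(* k is a regular version of the conditional distribution of V (which is X or
   Y, with values in [0,1]) given Z. *)
Definition cond_dist P V k : Prop :=
  (forall (A : set R) (B : set (d.-tuple R)), measurable A -> measurable B ->
     P (V @^-1` A `&` obsZ @^-1` B) =
       (\int[P]_(w in obsZ @^-1` B) k (obsZ w) A)%E) /\
  (forall z, cube z -> k z `[0, 1]%classic = 1%E).

Definition cond_cdf k (t : R) z : R := fine (k z `]-oo, t]%classic).

Definition continuous_cond k : Prop :=
  forall z, cube z -> continuous (cond_cdf k ^~ z).

Definition cond_quantile k (tau : R) z : R :=
  inf [set t | t \in `[0, 1] /\ tau <= cond_cdf k t z].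

End Conditional.

Section Scores.
Context {R : realType} {q : nat}.
Implicit Types (phi : R -> 'cV[R]_q).

Definition phi_supp phi (k : 'I_q) : set R :=
  closure [set u | u \in `[0, 1] /\ phi u k 0 != 0].

Definition tau_min phi : R := inf (\bigcup_k phi_supp phi k).
Definition tau_max phi : R := sup (\bigcup_k phi_supp phi k).

Definition score phi : Prop :=
  (forall k : 'I_q,
    [/\ compact (phi_supp phi k) /\ phi_supp phi k `<=` `]0, 1[%classic,
        [lipschitz phi u k 0 | u in `[0, 1]%classic],
        \int[lebesgue_measure]_(u in `[0, 1]%classic) phi u k 0 = 0 &
        \int[lebesgue_measure]_(u in `[0, 1]%classic) (phi u k 0) ^+ 2 = 1]) /\
  (forall c : 'rV[R]_q,
    (forall u, u \in `[0, 1] -> c *m phi u = 0) -> c = 0).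

End Scores.

Section SupNorms.
Context {R : realType} {d q : nat}.
Implicit Types (k : R.-pker (d.-tuple R) ~> R) (phi : R -> 'cV[R]_q)
  (f : R -> d.-tuple R -> R).

Definition quantile_range phi k (z : d.-tuple R) : set R :=
  `[cond_quantile k (tau_min phi) z, cond_quantile k (tau_max phi) z]%classic.

(* Extended-real valued: f need not be bounded. *)
Definition supnorm_in phi k f : \bar R :=
  ereal_sup [set ereal_sup [set `|f t z|%:E | t in quantile_range phi k z]
            | z in cube].

Definition supnorm_out phi k f : \bar R :=
  ereal_sup [set ereal_sup [set `|f t z|%:E
                           | t in `[0, 1]%classic `\` quantile_range phi k z]
            | z in cube].

End SupNorms.

Section Asymptotics.
Context {dO : measure_display} {Omega : measurableType dO} {R : realType}.
Implicit Types (Pr : probability Omega R).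

(* Nothing makes sup norms over uncountable sets, or arbitrary estimators,
   measurable; probabilities of such events are outer probabilities, which
   agree with Pr on measurable events.  Sample sizes are positive. *)
Definition bigO_P Pr (X : nat -> Omega -> \bar R) (a : nat -> R) : Prop :=
  forall e : R, 0 < e -> exists2 M : R, 0 < M &
    (ereal_sup
      [set (mu_ext Pr [set w | M%:E < `|X n w * (a n)^-1%:E|])%E
      | n in [set n | (0 < n)%N]] < e%:E)%E.

Definition cvg_in_prob Pr (p q : nat) (A : nat -> Omega -> 'M[R]_(p, q))
    (B : 'M[R]_(p, q)) : Prop :=
  forall e : R, 0 < e ->
    mu_ext Pr [set w | e < `|A n w - B|] @[n --> \oo] --> 0%E.

Definition iid_from Pr (d' : measure_display) (S : measurableType d')
    (P : probability S R) (W : nat -> {mfun Omega >-> S}) : Prop :=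
  (forall i A, measurable A -> distribution Pr (W i) A = P A) /\
  (forall (s : seq nat) (A : nat -> set S), uniq s ->
     (forall i, measurable (A i)) ->
     Pr (\big[setI/setT]_(i <- s) (W i @^-1` A i)) =
       (\prod_(i <- s) Pr (W i @^-1` A i))%E).

(* Nonvanishing because bigO_P divides by the rate. *)
Definition rate (a : nat -> R) : Prop :=
  (forall n, (0 < n)%N -> a n != 0) /\ a n @[n --> \oo] --> 0.

End Asymptotics.

Section Estimators.
Context {R : realType} {d : nat}.

Definition cdf_estimator : Type :=
  forall n, n.-tuple (R * d.-tuple R) -> R -> d.-tuple R -> R.

Definition cdf_estimator_ok (Fhat : cdf_estimator) : Prop :=
  forall n (s : n.-tuple (R * d.-tuple R)), (0 < n)%N ->
    (forall i, (tnth s i).1 \in `[0, 1] /\ cube (tnth s i).2) ->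
  forall z, cube z ->
    [/\ {within `[0, 1]%classic, continuous (Fhat n s ^~ z)},
        {in `[0, 1] &, {homo Fhat n s ^~ z : t u / t <= u}},
        Fhat n s 0 z = 0 &
        Fhat n s 1 z = 1].

End Estimators.
Arguments cdf_estimator : clear implicits.

Section Statistic.
Context {dO : measure_display} {Omega : measurableType dO} {R : realType}
  {d q : nat}.
Variables (W : nat -> Omega -> obs R d) (phi : R -> 'cV[R]_q)
  (FhatX FhatY : cdf_estimator R d).

Definition sample (V : obs R d -> R) (n : nat) (w : Omega) :
    n.-tuple (R * d.-tuple R) :=
  [tuple (V (W i w), obsZ (W i w)) | i < n].

Definition fitted (V : obs R d -> R) (Fhat : cdf_estimator R d) (n : nat)
    (w : Omega) (t : R) (z : d.-tuple R) : R :=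
  Fhat n (sample V n w) t z.

Definition U_hat (V : obs R d -> R) (Fhat : cdf_estimator R d) (n : nat)
    (i : nat) (w : Omega) : R :=
  fitted V Fhat n w (V (W i w)) (obsZ (W i w)).

Definition rho_hat (n : nat) (w : Omega) : 'M[R]_q :=
  n%:R^-1 *: \sum_(i < n) phi (U_hat obsX FhatX n i w) *m
                          (phi (U_hat obsY FhatY n i w))^T.

End Statistic.

Section Target.
Context {R : realType} {d q : nat}.

Definition U_true (V : obs R d -> R) (k : R.-pker (d.-tuple R) ~> R)
    (w : obs R d) : R :=
  cond_cdf k (V w) (obsZ w).

Definition rho (phi : R -> 'cV[R]_q) (P : probability (obs R d) R)
    (kX kY : R.-pker (d.-tuple R) ~> R) : 'M[R]_q :=
  \matrix_(i, j) fine 'E_P[fun w =>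
    (phi (U_true obsX kX w) *m (phi (U_true obsY kY w))^T) i j].

End Target.

(* Main.v *)
From HB Require Import structures.
Require Import Defs.
From mathcomp Require Import all_boot all_order all_algebra.
From mathcomp Require Import all_classical all_reals all_analysis.
From mathcomp Require Import measurable_realfun ring lra.

Set Implicit Arguments.
Unset Strict Implicit.
Unset Printing Implicit Defensive.

Import Order.TTheory GRing.Theory Num.Theory.
Import numFieldNormedType.Exports.

Local Open Scope classical_set_scope.
Local Open Scope ring_scope.

(** Each entry of the statistic is compared with the oracle average
    [n^-1 * \sum_i phi_k(U_1i) phi_l(U_2i)], which uses the true conditional
    distribution functions.  The oracle average converges in probability to
    the entry of [rho] by the weak law of large numbers for a bounded function
    of an i.i.d. sample ([weak_law], by Chebyshev's inequality), so it remains
    to bound the difference of the two averages, uniformly in the summands.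

    A score vanishes outside [tau_min, tau_max] and is Lipschitz, so
    [phi u = phi (clamp u)] on [0, 1], where [clamp] is the projection onto
    [tau_min, tau_max] ([phi_clamp]).  Hence only the distance between the
    clamped values of [F(t|z)] and [Fhat(t|z)] matters.  If [t] lies between
    the conditional quantiles of levels [tau_min] and [tau_max], this distance
    is at most the sup norm over the quantile range.  If [t] lies below the
    lower quantile [a], then [F(t|z) <= tau_min] clamps to [tau_min], while
    monotonicity of the estimator gives
    [Fhat(t|z) <= Fhat(a|z) <= F(a|z) + err = tau_min + err], so that the
    clamped values again differ by at most [err]; the upper end is symmetric
    ([clamp_close], [clamped_cdf_close]).  Thus the sup norm over the quantile
    range controls the error at every point of [0, 1], and it tends to zero in
    outer probability because it is of the order of a vanishing rate
    ([bigO_asymp_null]).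

    All of this holds when every observation lies in the unit cube, which
    fails with probability zero ([asymp_null_obs_cube]).  The bad events need
    not be measurable, so the argument is run with outer probabilities: a
    sequence of events is asymptotically null when its outer probability tends
    to zero, and such sequences are stable under subsets and finite unions.
    The oracle average is a genuine random variable because
    [(t, z) |-> F(t|z)] is jointly measurable ([measurable_U_true]). *)

(** * Weak law of large numbers in outer probability *)

Lemma bounded_integrable (R : realType) (dT : measure_display)
    (T : measurableType dT) (Q : probability T R) (f : T -> R) (C : R) :
  measurable_fun setT f -> (forall x, `|f x| <= C) ->
  Q.-integrable setT (EFin \o f).
Proof.
move=> mf fC; apply: measurable_bounded_integrable => //.
  by rewrite (le_lt_trans (@probability_le1 _ _ _ Q _ measurableT))// ltry.
exists C; split; first exact: num_real.
by move=> M CM x _; exact: le_trans (fC x) (ltW CM).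
Qed.

(** The joint law of an independent pair agrees with the product of the
    marginal laws on rectangles, hence everywhere; Fubini's theorem on the
    product then separates the two factors. *)
Lemma integral_prod_of_indep (R : realType) (dO dS : measure_display)
    (Omega : measurableType dO) (S : measurableType dS)
    (Q : probability Omega R) (P : probability S R)
    (W1 W2 : {mfun Omega >-> S}) (f g : S -> R) (C : R) :
  (forall A B, measurable A -> measurable B ->
    Q (W1 @^-1` A `&` W2 @^-1` B) = (P A * P B)%E) ->
  measurable_fun setT f -> measurable_fun setT g ->
  (forall x, `|f x| <= C) -> (forall x, `|g x| <= C) ->
  (\int[Q]_w (f (W1 w) * g (W2 w))%:E =
     (\int[P]_x (f x)%:E) * \int[P]_x (g x)%:E)%E.
Proof.
move=> PW mf mg fC gC.
have intf : P.-integrable setT (EFin \o f) by exact: bounded_integrable fC.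
have intg : P.-integrable setT (EFin \o g) by exact: bounded_integrable gC.
have mW : measurable_fun setT (fun w => (W1 w, W2 w)).
  by apply: measurable_fun_pair; exact: measurable_funPT.
pose WW := HB.pack_for {mfun Omega >-> (S * S)%type} (fun w => (W1 w, W2 w))
  (isMeasurableFun.Build _ _ _ _ _ mW).
pose h (p : S * S) : \bar R := (f p.1 * g p.2)%:E.
have mh : measurable_fun [set: S * S] h.
  apply/measurable_EFinP; apply: measurable_funM.
    by apply: measurableT_comp => //; exact: measurable_fst.
  by apply: measurableT_comp => //; exact: measurable_snd.
have hC p : `|f p.1 * g p.2| <= C * C by rewrite normrM ler_pM.
have joint A : measurable A -> (P \x P)%E A = distribution Q WW A.
  by apply: product_measure_unique => A1 A2 mA mB; exact: PW.
have inth : Q.-integrable setT (h \o WW).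
  apply: (@bounded_integrable _ _ _ _ (fun w => f (W1 w) * g (W2 w)) (C * C)).
  - exact/measurable_EFinP/(measurableT_comp mh mW).
  - by move=> w; exact: (hC (W1 w, W2 w)).
transitivity (\int[distribution Q WW]_p h p)%E.
  by rewrite (@integral_distribution _ _ _ _ _ Q WW _ mh inth).
have -> : (\int[distribution Q WW]_p h p = \int[P \x P]_p h p)%E.
  by apply: eq_measure_integral => A mA _; exact/esym/joint.
have inth' : (P \x P)%E.-integrable setT h.
  apply/integrableP; split => //.
  have -> : (\int[P \x P]_p `|h p| = \int[distribution Q WW]_p `|h p|)%E.
    by apply: eq_measure_integral => A mA _; exact: joint.
  rewrite ge0_integral_distribution//; last exact: measurableT_comp.
  by move/integrableP : inth => [].
rewrite -(integral12_prod_meas1 inth')/=.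
transitivity (\int[P]_x ((f x)%:E * \int[P]_y (g y)%:E))%E.
  by apply: eq_integral => x _; rewrite -integralZl.
have -> : (\int[P]_y (g y)%:E = (fine (\int[P]_y (g y)%:E))%:E)%E.
  by rewrite fineK//; exact: (integrable_fin_num measurableT intg).
by rewrite integralZr.
Qed.

(** Expanding the square leaves only the [n] diagonal terms: this linear growth
    of the second moment is what makes the weak law work. *)
Lemma sum_sqr_le (R : realType) (dO : measure_display)
    (Omega : measurableType dO) (Q : probability Omega R)
    (Y : nat -> Omega -> R) (C : R) (n : nat) :
  (forall i, measurable_fun setT (Y i)) ->
  (forall i w, `|Y i w| <= C) ->
  (forall i j, i != j -> \int[Q]_w (Y i w * Y j w)%:E = 0)%E ->
  (\int[Q]_w ((\sum_(i < n) Y i w) ^+ 2)%:E <= (n%:R * C ^+ 2)%:E)%E.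
Proof.
move=> mY YC orth.
have mYY i j : measurable_fun setT (fun w => Y i w * Y j w).
  exact: measurable_funM.
have YYC i j w : `|Y i w * Y j w| <= C ^+ 2.
  by rewrite normrM expr2 ler_pM.
have intYY i j : Q.-integrable setT (fun w => (Y i w * Y j w)%:E).
  exact: bounded_integrable (YYC i j).
have -> : (\int[Q]_w ((\sum_(i < n) Y i w) ^+ 2)%:E =
    \int[Q]_w (\sum_(i < n) \sum_(j < n) (Y i w * Y j w)%:E))%E.
  apply: eq_integral => w _; rewrite expr2 mulr_suml -sumEFin.
  by apply: eq_bigr => i _; rewrite mulr_sumr -sumEFin.
rewrite integral_sum//; last first.
  by move=> i; apply: integrable_sum => // j _; exact: intYY.
apply: (@le_trans _ _ (\sum_(i < n) (C ^+ 2)%:E)%E); last first.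
  by rewrite sumEFin sumr_const card_ord mulr_natl.
apply: lee_sum => i _.
rewrite integral_sum//.
rewrite (bigD1 i)//= big1 ?adde0; last by move=> j ji; rewrite orth// eq_sym.
apply: (@le_trans _ _ (\int[Q]_w (cst (C ^+ 2)%:E) w)%E).
  apply: le_integral => //; first exact: finite_measure_integrable_cst.
  by move=> w _; rewrite lee_fin; exact: le_trans (ler_norm _) (YYC i i w).
by rewrite integral_cst//= probability_setT mule1.
Qed.

(** Outer probability, because the events defined through sup norms over
    uncountable sets or through arbitrary estimators need not be
    measurable. *)
Definition asymp_null (R : realType) (dO : measure_display)
    (Omega : measurableType dO) (Q : probability Omega R)
    (E : nat -> set Omega) : Prop :=
  mu_ext Q (E n) @[n --> \oo] --> 0%E.

Lemma asymp_null_sub (R : realType) (dO : measure_display)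
    (Omega : measurableType dO) (Q : probability Omega R)
    (E F : nat -> set Omega) :
  (\forall n \near \oo, E n `<=` F n) -> asymp_null Q F -> asymp_null Q E.
Proof.
move=> EF; apply: squeeze_cvge; last exact: cvg_cst.
near=> n; rewrite mu_ext_ge0//=; apply: le_mu_ext; near: n; exact: EF.
Unshelve. all: by end_near. Qed.

Lemma asymp_nullU (R : realType) (dO : measure_display)
    (Omega : measurableType dO) (Q : probability Omega R)
    (E F : nat -> set Omega) :
  asymp_null Q E -> asymp_null Q F -> asymp_null Q (fun n => E n `|` F n).
Proof.
move=> E0 F0.
have EF0 : (mu_ext Q (E n) + mu_ext Q (F n))%E @[n --> \oo] --> 0%E.
  by rewrite -[X in _ --> X](adde0 0%E); apply: cvgeD.
apply: squeeze_cvge EF0; last exact: cvg_cst.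
near=> n; rewrite mu_ext_ge0//=; exact: (outer_measureU2 (mu_ext Q)).
Unshelve. all: by end_near. Qed.

Lemma asymp_null_exists (R : realType) (dO : measure_display)
    (Omega : measurableType dO) (Q : probability Omega R) (I : finType)
    (E : I -> nat -> set Omega) :
  (forall i, asymp_null Q (E i)) ->
  asymp_null Q (fun n => [set w | exists i, E i n w]).
Proof.
move=> E0.
suff main (s : seq I) :
    asymp_null Q (fun n => [set w | exists2 i, i \in s & E i n w]).
  apply: asymp_null_sub _ (main (enum I)).
  by apply: nearW => n w [i Ew]; exists i; rewrite ?mem_enum.
elim: s => [|j s IHs].
  apply: (@asymp_null_sub _ _ _ _ _ (fun=> set0)).
    by apply: nearW => n w [].
  rewrite /asymp_null [mu_ext Q set0]outer_measure0; exact: cvg_cst.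
apply: asymp_null_sub _ (asymp_nullU (E0 j) IHs).
apply: nearW => n w [i]; rewrite inE => /orP[/eqP-> Ew|si Ew]; first by left.
by right; exists i.
Qed.

(** The explicit rate [c / n] is the one that Chebyshev's inequality gives. *)
Lemma asymp_null_measurable (R : realType) (dO : measure_display)
    (Omega : measurableType dO) (Q : probability Omega R)
    (E : nat -> set Omega) (c : R) :
  (forall n, measurable (E n)) ->
  (forall n, (0 < n)%N -> (Q (E n) <= (c / n%:R)%:E)%E) -> asymp_null Q E.
Proof.
move=> mE Ec.
have cn0 : (c / n%:R)%:E @[n --> \oo] --> 0%E.
  apply: cvg_EFin; first exact: nearW.
  rewrite -[X in _ --> X](mulr0 c); apply: cvgM; first exact: cvg_cst.
  apply/gtr0_cvgV0; last exact: cvgr_idn.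
  by near=> n; rewrite ltr0n; near: n; exists 1%N.
apply: squeeze_cvge cn0; last exact: cvg_cst.
near=> n; rewrite mu_ext_ge0//= measurable_mu_extE// Ec//.
by near: n; exists 1%N.
Unshelve. all: by end_near. Qed.

(** Centring [f] makes distinct summands orthogonal. *)
Lemma weak_law (R : realType) (dO dS : measure_display)
    (Omega : measurableType dO) (S : measurableType dS)
    (Q : probability Omega R) (P : probability S R)
    (W : nat -> {mfun Omega >-> S}) (f : S -> R) (C e : R) :
  iid_from Q P W -> measurable_fun setT f -> (forall x, `|f x| <= C) ->
  0 < e ->
  asymp_null Q (fun n => [set w |
    e < `|n%:R^-1 * (\sum_(i < n) f (W i w)) - fine 'E_P[f]|]).
Proof.
move=> [law indep] mf fC e0.
set m := fine _; pose D := C + `|m|.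
pose g x := f x - m.
have mg : measurable_fun setT g by exact: measurable_funB.
have gD x : `|g x| <= D by rewrite (le_trans (ler_normB _ _))// lerD.
have intf : P.-integrable setT (EFin \o f) by exact: bounded_integrable fC.
have g0 : (\int[P]_x (g x)%:E = 0)%E.
  have Ef : (\int[P]_x (f x)%:E = m%:E)%E.
    by rewrite /m unlock fineK//; exact: (integrable_fin_num measurableT intf).
  under eq_integral do rewrite EFinB.
  rewrite integralB//=; last exact: finite_measure_integrable_cst.
  by rewrite Ef integral_cst//= probability_setT mule1 subee.
have mgW i : measurable_fun setT (fun w => g (W i w)).
  by apply: measurableT_comp => //; exact: measurable_funPT.
pose Sg n w := \sum_(i < n) g (W i w).
have mS n : measurable_fun setT (Sg n) by exact: measurable_sum.
have meanE n w : (0 < n)%N ->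
    n%:R^-1 * (\sum_(i < n) f (W i w)) - m = n%:R^-1 * Sg n w.
  move=> n0; rewrite /Sg big_split/= mulrDr sumr_const card_ord.
  by rewrite -[- m *+ n]mulr_natr mulrCA mulVf ?mulr1// pnatr_eq0 -lt0n.
have mE n : measurable [set w |
    e < `|n%:R^-1 * (\sum_(i < n) f (W i w)) - m|].
  have -> : [set w | e < `|n%:R^-1 * (\sum_(i < n) f (W i w)) - m|] =
    (fun w => `|n%:R^-1 * (\sum_(i < n) f (W i w)) - m|) @^-1` `]e, +oo[.
    by apply/seteqP; split => w /=; rewrite in_itv/= andbT.
  rewrite -[X in measurable X]setTI.
  suff: measurable_fun setT
      (fun w => `|n%:R^-1 * (\sum_(i < n) f (W i w)) - m|) by apply.
  apply: measurableT_comp => //; apply: measurable_funB => //.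
  apply: measurable_funM => //; apply: measurable_sum => i.
  by apply: measurableT_comp => //; exact: measurable_funPT.
apply: (@asymp_null_measurable _ _ _ _ _ (D ^+ 2 / e ^+ 2)) => // n n0.
have nR0 : 0 < n%:R :> R by rewrite ltr0n.
pose X := HB.pack_for {mfun Omega >-> R} (Sg n)
  (isMeasurableFun.Build _ _ _ _ _ (mS n)).
have en0 : 0 < e * n%:R by rewrite mulr_gt0.
have msq : measurable_fun [set: R] (fun x : R => x ^+ 2).
  exact: measurable_funX.
have sq_nd : {in Num.nneg &, {homo (fun x : R => x ^+ 2) : x y / x <= y}}.
  by move=> x y; rewrite !nnegrE => x0 y0 xy; rewrite ler_pXn2r ?nnegrE.
have := @markov _ _ _ Q X (fun x => x ^+ 2) _ en0 msq
  (fun r _ => sqr_ge0 r) sq_nd.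
rewrite unlock/= => mk.
have vS : (\int[Q]_w (`|Sg n w| ^+ 2)%:E <= (n%:R * D ^+ 2)%:E)%E.
  under eq_integral do rewrite real_normK ?num_real//.
  apply: (@sum_sqr_le _ _ _ _ (fun i w => g (W i w)) D n) => // i j ij.
  rewrite (@integral_prod_of_indep _ _ _ _ _ Q P _ _ g g D _ mg mg gD gD)
    ?g0 ?mule0// => A B mA mB.
  have := indep [:: i; j] (fun k => if k == i then A else B).
  rewrite !big_cons !big_nil setIT mule1 eqxx eq_sym (negbTE ij).
  rewrite -(law i A mA) -(law j B mB).
  by apply => [|k]; [rewrite /= inE ij|case: ifP].
rewrite -(@lee_pmul2l _ ((e * n%:R) ^+ 2)%:E)//; last first.
  by rewrite lte_fin exprn_gt0.
apply: (@le_trans _ _ (((e * n%:R) ^+ 2)%:E *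
    Q [set w | ((e * n%:R)%:E <= `|(Sg n w)%:E|)%E])%E).
  rewrite lee_pmul2l//; last by rewrite lte_fin exprn_gt0.
  apply: le_measure; rewrite ?inE//.
    rewrite -[X in measurable X]setTI.
    have -> : [set w | ((e * n%:R)%:E <= `|(Sg n w)%:E|)%E] =
        (fun w => `|Sg n w|) @^-1` `[e * n%:R, +oo[.
      by apply/seteqP; split => w /=; rewrite in_itv/= andbT lee_fin.
    suff: measurable_fun setT (fun w => `|Sg n w|) by apply.
    exact: measurableT_comp.
  move=> w /=; rewrite meanE// normrM gtr0_norm ?invr_gt0// lee_fin.
  by rewrite mulrC ltr_pdivlMr// => /ltW.
apply: (le_trans mk (le_trans vS _)); rewrite -EFinM lee_fin.
rewrite exprMn [leRHS](_ : _ = n%:R * D ^+ 2)//.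
by field; rewrite !gt_eqF.
Qed.

Section Outer.
Context {R : realType} {dO : measure_display} {Omega : measurableType dO}
  (Q : probability Omega R).

Lemma asymp_null_small (E : nat -> set Omega) :
  (forall e : R, 0 < e -> \forall n \near \oo, (mu_ext Q (E n) <= e%:E)%E) ->
  asymp_null Q E.
Proof.
move=> small; apply/fine_cvgP; split.
  have := small 1 ltr01; apply: filterS => n En1.
  rewrite ge0_fin_numE ?mu_ext_ge0//.
  exact: le_lt_trans En1 (ltry _).
apply/cvgrPdist_le => e /small; apply: filterS => n Ene.
rewrite sub0r normrN ger0_norm ?fine_ge0 ?mu_ext_ge0//=.
rewrite -lee_fin fineK// ge0_fin_numE ?mu_ext_ge0//.
exact: le_lt_trans Ene (ltry _).
Qed.

(** Since [del / `|a n|] eventually exceeds the constant [M] of the O_P bound,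
    the event that [X n] exceeds [del] is eventually contained in the event
    that [`|X n / a n|] exceeds [M]. *)
Lemma bigO_asymp_null (X : nat -> Omega -> \bar R) (a : nat -> R) (del : R) :
  bigO_P Q X a -> rate a -> 0 < del ->
  asymp_null Q (fun n => [set w | (del%:E < X n w)%E]).
Proof.
move=> Oa [a0 acvg] del0; apply: asymp_null_small => e e0.
have [M M0 /ltW supM] := Oa e e0.
near=> n.
have n0 : (0 < n)%N by near: n; exists 1%N.
apply: le_trans supM.
apply: (le_trans _ (ereal_sup_ubound _)); last by exists n.
apply: le_mu_ext => w /= delX.
have an0 : 0 < `|a n| by rewrite normr_gt0 a0.
have Man : M * `|a n| < del.
  rewrite mulrC -ltr_pdivlMr//.
  near: n; apply: (cvgr0_norm_lt _ acvg); exact: divr_gt0.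
rewrite abseM abse_EFin normfV lte_pdivlMr// -EFinM.
by rewrite (lt_le_trans _ (lee_abs _))// (lt_trans _ delX)// lte_fin.
Unshelve. all: by end_near. Qed.

End Outer.

(** * Conditional distribution functions and quantiles *)

(** Reindexing the conditional distribution given [Z] by whole observations: the
    threshold [V] becomes a function of the index of the kernel, and
    [F(V|Z)] becomes the mass of a section of a fixed measurable set. *)
Section PullbackKernel.
Context (R : realType) (d1 d2 d3 : measure_display) (T1 : measurableType d1)
  (T2 : measurableType d2) (T3 : measurableType d3) (k : R.-pker T2 ~> T3)
  (h : T1 -> T2).
Hypothesis mh : measurable_fun setT h.

Definition pullback_kernel (x : T1) : {measure set T3 -> \bar R} := k (h x).

Let pullback_measurable U : measurable U ->
  measurable_fun setT (fun x => pullback_kernel x U).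
Proof.
move=> mU; exact: (measurableT_comp (measurable_kernel k U mU) mh).
Qed.

HB.instance Definition _ :=
  isKernel.Build _ _ T1 T3 R pullback_kernel pullback_measurable.

Let pullback_prob x : pullback_kernel x setT = 1%E.
Proof. exact: prob_kernel. Qed.

HB.instance Definition _ :=
  Kernel_isProbability.Build _ _ T1 T3 R pullback_kernel pullback_prob.

Lemma measurable_kernel_section (A : set (T1 * T3)) : measurable A ->
  measurable_fun setT (fun x => k (h x) (xsection A x)).
Proof.
move=> mA.
apply: (measurable_fun_xsection_finite_kernel pullback_kernel).
by rewrite inE.
Qed.

End PullbackKernel.

Section CondCdf.
Context {R : realType} {d : nat}.
Implicit Types (V : obs R d -> R) (k : R.-pker (d.-tuple R) ~> R)
  (z : d.-tuple R).

Lemma measurable_obsZ : measurable_fun setT (@obsZ R d).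
Proof. exact: measurable_snd. Qed.

Lemma measurable_obsX : measurable_fun setT (@obsX R d).
Proof. exact: measurableT_comp measurable_fst measurable_fst. Qed.

Lemma measurable_obsY : measurable_fun setT (@obsY R d).
Proof. exact: measurableT_comp measurable_snd measurable_fst. Qed.

(** [F(V|Z)] is the mass under the pulled back kernel of the section of
    [{(w, t) | t <= V w}] at [w]. *)
Lemma measurable_U_true V k : measurable_fun setT V ->
  measurable_fun setT (U_true V k).
Proof.
move=> mV.
pose A : set (obs R d * R) := [set p | p.2 <= V p.1].
have mA : measurable A.
  have -> : A = (fun p : obs R d * R => V p.1 - p.2) @^-1` `[0, +oo[.
    by apply/seteqP; split => p /=; rewrite in_itv/= andbT subr_ge0.
  rewrite -[X in measurable X]setTI.
  suff: measurable_fun setT (fun p : obs R d * R => V p.1 - p.2) by apply.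
  apply: measurable_funB; last exact: measurable_snd.
  exact: measurableT_comp mV measurable_fst.
have := measurable_kernel_section k measurable_obsZ mA.
move=> /(measurableT_comp (fine_measurable measurableT)); congr measurable_fun.
apply/funext => w; rewrite /U_true /cond_cdf /=; congr (fine (k _ _)).
by apply/seteqP; split => t /=; rewrite /xsection/= inE in_itv.
Qed.

Lemma cond_cdf_ge0 k t z : 0 <= cond_cdf k t z.
Proof. exact: fine_ge0. Qed.

Lemma cond_cdf_fin k t z : k z `]-oo, t]%classic \is a fin_num.
Proof.
by apply: (@kernel_finite_transition _ _ _ _ _ k z); exact: measurable_itv.
Qed.

Lemma cond_cdf_le1 k t z : cond_cdf k t z <= 1.
Proof.
rewrite -lee_fin fineK ?cond_cdf_fin// -(@prob_kernel _ _ _ _ _ k z).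
by apply: le_measure; rewrite ?inE.
Qed.

Lemma cond_cdf_nondecreasing k z : {homo cond_cdf k ^~ z : s t / s <= t}.
Proof.
move=> s t st; rewrite -lee_fin !fineK ?cond_cdf_fin//.
apply: le_measure; rewrite ?inE// => u /=; rewrite !in_itv/= => us.
exact: le_trans us st.
Qed.

Lemma cond_cdf1 k z : k z `[0, 1]%classic = 1%E -> cond_cdf k 1 z = 1.
Proof.
move=> k01; apply/eqP; rewrite eq_le cond_cdf_le1/= -lee_fin.
rewrite fineK ?cond_cdf_fin// -k01.
by apply: le_measure; rewrite ?inE// => u /=; rewrite !in_itv/= => /andP[].
Qed.

Lemma cond_cdf_lt0 k z t : k z `[0, 1]%classic = 1%E -> t < 0 ->
  cond_cdf k t z = 0.
Proof.
move=> k01 t0; rewrite /cond_cdf.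
suff -> : k z `]-oo, t]%classic = 0%E by [].
pose I : set R := `[0, 1]%classic; have kI : k z I = 1%E := k01.
have : (k z `]-oo, t]%classic + k z I <= 1)%E.
  rewrite -(@prob_kernel _ _ _ _ _ k z) -measureU//; last 2 first.
    exact: measurable_itv.
    apply/seteqP; split => // u []; rewrite /I /= !in_itv/= => ut /andP[u0 _].
    by have := le_lt_trans (le_trans u0 ut) t0; rewrite ltxx.
  by apply: le_measure; rewrite ?inE//; apply: measurableU => //;
    exact: measurable_itv.
rewrite kI.
have : (0 <= k z `]-oo, t]%classic)%E by exact: measure_ge0.
have := cond_cdf_fin k t z.
move: (k z `]-oo, t]%classic) => [r| |]//= _.
by rewrite -EFinD !lee_fin => r0 r1; congr EFin; lra.
Qed.

Section QuantileContinuous.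
Variables (k : R.-pker (d.-tuple R) ~> R) (z : d.-tuple R).
Hypothesis (k01 : k z `[0, 1]%classic = 1%E).
Hypothesis (kc : continuous (cond_cdf k ^~ z)).

(** No mass lies below 0, and continuity excludes an atom at 0. *)
Lemma cond_cdf0 : cond_cdf k 0 z = 0.
Proof.
apply/eqP; rewrite eq_le cond_cdf_ge0 andbT leNgt; apply/negP => F0.
have [e /= e0 Fe] := cvgr_gt _ (@kc 0) _ F0.
have : 0 < cond_cdf k (- (e / 2)) z.
  by apply: Fe; rewrite /= sub0r opprK gtr0_norm ?divr_gt0//; lra.
by rewrite cond_cdf_lt0 ?ltxx//; lra.
Qed.

Lemma cond_quantile_le tau t : t \in `[0, 1] -> tau <= cond_cdf k t z ->
  cond_quantile k tau z <= t.
Proof.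
move=> t01 taut; apply: ge_inf; last by [].
by exists 0 => u [+ _]; rewrite in_itv/= => /andP[].
Qed.

(** The intermediate value theorem gives a point of level [tau], so
    [F(q) <= tau] at the quantile [q]; continuity at [q] gives the reverse
    inequality, as [q] is an infimum of points of level at least [tau]. *)
Lemma cond_cdf_quantile tau : tau \in `[0, 1] ->
  cond_quantile k tau z \in `[0, 1] /\
  cond_cdf k (cond_quantile k tau z) z = tau.
Proof.
rewrite in_itv/= => /andP[tau0 tau1].
have [t0 t001 Ft0] : exists2 t, t \in `[0, 1] & cond_cdf k t z = tau.
  apply: IVT => //; first exact: continuous_subspaceT.
  by rewrite cond_cdf0 cond_cdf1// minEle maxEle ler01 tau0.
have qt0 : cond_quantile k tau z <= t0.
  by apply: cond_quantile_le; rewrite ?Ft0.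
have S0 : [set t | t \in `[0, 1] /\ tau <= cond_cdf k t z] !=set0.
  by exists t0; rewrite /= Ft0.
have q0 : 0 <= cond_quantile k tau z.
  by apply: lb_le_inf S0 _ => u [+ _]; rewrite in_itv/= => /andP[].
split.
  move: t001; rewrite !in_itv/= q0 => /andP[_ t01].
  exact: le_trans qt0 t01.
apply/eqP; rewrite eq_le; apply/andP; split.
  by rewrite -{2}Ft0; exact: cond_cdf_nondecreasing.
rewrite leNgt; apply/negP => Fq.
have [e /= e0 Fe] := cvgr_lt _ (@kc (cond_quantile k tau z)) _ Fq.
have lbS : has_lbound [set t | t \in `[0, 1] /\ tau <= cond_cdf k t z].
  by exists 0 => u [+ _]; rewrite in_itv/= => /andP[].
have [t [t01 taut] tq] := inf_adherent e0 (conj S0 lbS).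
suff : cond_cdf k t z < tau by rewrite ltNge taut.
apply: Fe; rewrite /= distrC ger0_norm ?subr_ge0; first by rewrite ltrBlDl.
exact: cond_quantile_le.
Qed.

End QuantileContinuous.

End CondCdf.

(** * Clamping and scores *)

Section Clamp.
Context {R : realType}.
Implicit Types (lo hi u v : R).

Definition clamp lo hi u : R := Num.min hi (Num.max lo u).

Lemma clamp_itv lo hi u : lo <= hi -> clamp lo hi u \in `[lo, hi].
Proof.
by move=> lohi; rewrite in_itv/= /clamp le_min ge_min lohi le_max !lexx.
Qed.

Lemma clamp_id lo hi u : lo <= u <= hi -> clamp lo hi u = u.
Proof.
by move=> /andP[lou uhi]; rewrite /clamp (max_idPr lou) (min_idPr uhi).
Qed.

Lemma clamp_low lo hi u : lo <= hi -> u <= lo -> clamp lo hi u = lo.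
Proof.
by move=> lohi ulo; rewrite /clamp (max_idPl ulo) (min_idPr lohi).
Qed.

Lemma clamp_high lo hi u : hi <= u -> clamp lo hi u = hi.
Proof. by move=> hiu; apply/min_idPl; rewrite le_max hiu orbT. Qed.

Lemma clamp_lipschitz lo hi u v :
  `|clamp lo hi u - clamp lo hi v| <= `|u - v|.
Proof.
wlog uv : u v / u <= v.
  by move=> wl; have [/wl//|/ltW/wl] := leP u v; rewrite distrC (distrC v).
have clamp_mono : clamp lo hi u <= clamp lo hi v.
  by rewrite /clamp le_min ge_min lexx/= ge_min ge_max !le_max lexx uv !orbT.
rewrite distrC (distrC u) !ger0_norm ?subr_ge0//.
have max_le : Num.max lo v <= Num.max lo u + (v - u).
  rewrite ge_max; apply/andP; split.
    by rewrite ler_wpDr ?subr_ge0// le_max lexx.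
  by rewrite -lerBlDr subKr le_max lexx orbT.
rewrite lerBlDl -lerBlDr le_min !lerBlDr; apply/andP; split.
  by rewrite ler_wpDr ?subr_ge0// ge_min lexx.
by rewrite (le_trans _ max_le)// ge_min lexx orbT.
Qed.

(** Here [a] and [b] play the role of the quantiles of [F] at levels [lo] and
    [hi].  Only the values of [G] on [a, b] are controlled; outside, [F] clamps
    to the nearer bound, and monotonicity prevents [G] from leaving the
    [del]-neighbourhood of that bound on the inner side. *)
Lemma clamp_close lo hi a b (F G : R -> R) (del : R) :
  a \in `[0, 1] -> b \in `[0, 1] -> lo <= hi -> F a = lo -> F b = hi ->
  a <= b ->
  {in `[0, 1] &, {homo F : s t / s <= t}} ->
  {in `[0, 1] &, {homo G : s t / s <= t}} ->
  (forall t, t \in `[a, b] -> `|F t - G t| <= del) ->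
  forall t, t \in `[0, 1] -> `|clamp lo hi (F t) - clamp lo hi (G t)| <= del.
Proof.
move=> a01 b01 lohi Fa Fb ab homF homG close t t01.
have [ta|at_] := ltP t a.
  have Ft : F t <= lo by rewrite -Fa homF// ltW.
  have Gt : G t <= lo + del.
    apply: (@le_trans _ _ (G a)); first by rewrite homG// ltW.
    have := close a; rewrite in_itv/= lexx ab Fa => /(_ isT).
    by rewrite distrC ler_distl => /andP[].
  rewrite (clamp_low lohi Ft) distrC.
  have del0 : 0 <= del.
    by apply: le_trans (close a _); rewrite ?in_itv/= ?lexx.
  have [Glo|loG] := leP (G t) lo.
    by rewrite clamp_low// subrr normr0.
  rewrite -[X in _ - X](clamp_low lohi (lexx lo)).
  apply: (le_trans (clamp_lipschitz _ _ _ _)).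
  by rewrite gtr0_norm ?subr_gt0// lerBlDl.
have [bt|tb] := ltP b t.
  have Ft : hi <= F t by rewrite -Fb homF// ltW.
  have Gt : hi - del <= G t.
    apply: (@le_trans _ _ (G b)); last by rewrite homG// ltW.
    have := close b; rewrite in_itv/= lexx ab Fb => /(_ isT).
    by rewrite distrC ler_distl => /andP[].
  rewrite (clamp_high lo Ft).
  have del0 : 0 <= del.
    by apply: le_trans (close a _); rewrite ?in_itv/= ?lexx.
  have [hiG|Ghi] := leP hi (G t).
    by rewrite clamp_high// subrr normr0.
  rewrite -[X in X - _](clamp_high lo (lexx hi)).
  apply: (le_trans (clamp_lipschitz _ _ _ _)).
  by rewrite gtr0_norm ?subr_gt0// lerBlDl -lerBlDr.
apply: (le_trans (clamp_lipschitz _ _ _ _)); apply: close.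
by rewrite in_itv/= at_.
Qed.

End Clamp.

Lemma lipschitz_measurable (R : realType) (f : R -> R) (L : R) : 0 <= L ->
  (forall u v, `|f u - f v| <= L * `|u - v|) -> measurable_fun setT f.
Proof.
move=> L0 lip; apply: continuous_measurable_fun => u.
apply/cvgrPdist_le => e e0.
have L1 : 0 < L + 1 by rewrite ltr_wpDl.
near=> v; apply: (le_trans (lip u v)).
have : `|u - v| <= e / (L + 1).
  by near: v; apply: cvgr_dist_le => //; rewrite divr_gt0.
move=> /(ler_wpM2l L0)/le_trans; apply.
by rewrite mulrCA ler_piMr ?(ltW e0)// ler_pdivrMr// mul1r lerDl.
Unshelve. all: by end_near. Qed.

Section Score.
Context {R : realType} {q : nat}.
Variables (phi : R -> 'cV[R]_q).
Hypothesis hphi : score phi.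

Let lo := tau_min phi.
Let hi := tau_max phi.
Let S := \bigcup_k phi_supp phi k.

Let supp_itv x : S x -> 0 <= x <= 1.
Proof.
move=> [k _ kx]; have [[_ sub] _ _ _] := hphi.1 k.
by have := sub _ kx; rewrite /= in_itv/= => /andP[/ltW-> /ltW->].
Qed.

Lemma tau_range : [/\ 0 <= lo, lo <= hi & hi <= 1].
Proof.
have lbS : has_lbound S by exists 0 => x /supp_itv /andP[].
have ubS : has_ubound S by exists 1 => x /supp_itv /andP[].
have [S0|/set0P Sn0] := eqVneq S set0.
  (* Without support points, both bounds are 0 by convention. *)
  by rewrite /lo /hi /tau_min /tau_max -/S S0 inf0 sup0; split.
split.
- by apply: lb_le_inf => // x /supp_itv /andP[].
- have [x Sx] := Sn0.
  by apply: (@le_trans _ _ x); [exact: ge_inf|exact: ub_le_sup].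
- by apply: ge_sup => // x /supp_itv /andP[].
Qed.

Let phi_eq0 k u : u \in `[0, 1] -> (u < lo) || (hi < u) -> phi u k 0 = 0.
Proof.
have lbS : has_lbound S by exists 0 => x /supp_itv /andP[].
have ubS : has_ubound S by exists 1 => x /supp_itv /andP[].
move=> u01 out; apply/eqP; apply: contraT => phiu.
have Su : S u by exists k => //; apply: subset_closure.
by case/orP: out; rewrite ltNge; [rewrite ge_inf|rewrite ub_le_sup].
Qed.

Lemma score_lipschitz k : exists2 L, 0 <= L &
  {in `[0, 1] &, forall u v, `|phi u k 0 - phi v k 0| <= L * `|u - v|}.
Proof.
have [_ [M [_ lip]] _ _] := hphi.1 k.
have M1 : M < `|M| + 1 by rewrite ltr_pwDr// ler_norm.
exists (`|M| + 1); first by rewrite addr_ge0.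
move=> u v u01 v01; exact: (lip _ M1 (u, v)).
Qed.

(** Below [tau_min] a score is zero, and it is zero at [tau_min] as well, by
    continuity, as soon as there is a point of [0, 1] below it; likewise above
    [tau_max]. *)
Lemma phi_clamp k u : u \in `[0, 1] -> phi u k 0 = phi (clamp lo hi u) k 0.
Proof.
move=> u01; have [lo0 lohi hi1] := tau_range.
have [L L0 lip] := score_lipschitz k.
have lim0 x : x \in `[0, 1] ->
    (forall e, 0 < e -> exists v, [/\ v \in `[0, 1], phi v k 0 = 0 &
      `|x - v| <= e]) -> phi x k 0 = 0.
  move=> x01 near0; apply/eqP; rewrite -normr_le0; apply/ler_addgt0Pr => e e0.
  have L1 : 0 < L + 1 by rewrite ltr_wpDl.
  have [v [v01 phiv xv]] := near0 (e / (L + 1)) (divr_gt0 e0 L1).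
  rewrite add0r -[phi x k 0]subr0 -phiv (le_trans (lip _ _ x01 v01))//.
  rewrite (le_trans (ler_wpM2l L0 xv))// mulrCA ler_piMr ?(ltW e0)//.
  by rewrite ler_pdivrMr// mul1r lerDl.
move: (u01); rewrite in_itv/= => /andP[u0 u1].
have [ulo|lou] := ltP u lo.
  rewrite clamp_low ?(ltW ulo)// (phi_eq0 _ u01) ?ulo//; apply/esym/lim0.
    by rewrite in_itv/= lo0 (le_trans lohi).
  (* A zero of the score within [e] below [lo]; the maximum with [u] keeps it
     in [0, 1]. *)
  move=> e e0; exists (Num.max u (lo - e)).
  have vlo : Num.max u (lo - e) < lo by rewrite gt_max ulo gtrBl.
  have v01 : Num.max u (lo - e) \in `[0, 1].
    by rewrite in_itv/= le_max u0/= (le_trans (ltW vlo))// (le_trans lohi).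
  split=> //; first by rewrite phi_eq0// vlo.
  by rewrite gtr0_norm ?subr_gt0// lerBlDr -lerBlDl le_max lexx orbT.
have [hiu|uhi] := ltP hi u.
  rewrite clamp_high ?(ltW hiu)// (phi_eq0 _ u01) ?hiu ?orbT//.
  apply/esym/lim0; first by rewrite in_itv/= hi1 (le_trans lo0).
  move=> e e0; exists (Num.min u (hi + e)).
  have hiv : hi < Num.min u (hi + e) by rewrite lt_min hiu ltrDl.
  have v01 : Num.min u (hi + e) \in `[0, 1].
    by rewrite in_itv/= ge_min u1/= (le_trans _ (ltW hiv))// (le_trans lo0).
  split=> //; first by rewrite phi_eq0// hiv orbT.
  by rewrite ltr0_norm ?subr_lt0// opprB lerBlDl ge_min lexx orbT.
by rewrite clamp_id// lou.
Qed.

(** A score is only constrained on [0, 1].  Precomposing it with the clamp gives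
    a function on the whole line that is bounded, measurable because Lipschitz,
    and that depends on its argument only through the clamped value. *)
Lemma score_extension k : exists (f : R -> R) (L B : R),
  [/\ 0 <= L, 0 <= B, {in `[0, 1], forall u, phi u k 0 = f u},
      forall u, `|f u| <= B &
      forall u v, `|f u - f v| <= L * `|clamp lo hi u - clamp lo hi v|].
Proof.
have [lo0 lohi hi1] := tau_range.
have [L L0 lip] := score_lipschitz k.
have c01 u : clamp lo hi u \in `[0, 1].
  have := clamp_itv u lohi; rewrite !in_itv/= => /andP[cl ch].
  by rewrite (le_trans lo0)// (le_trans ch).
exists (fun u => phi (clamp lo hi u) k 0), L, (`|phi 0 k 0| + L).
split=> // [|u u01|u|u v].
- by rewrite addr_ge0.
- exact: phi_clamp.
- have z01 : (0 : R) \in `[0, 1] by rewrite in_itv/= lexx ler01.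
  rewrite -[X in `|X|](subrK (phi 0 k 0)) addrC (le_trans (ler_normD _ _))//.
  rewrite lerD2l (le_trans (lip _ _ (c01 u) z01))// ler_piMr// subr0.
  by have := c01 u; rewrite in_itv/= => /andP[c0 c1]; rewrite ger0_norm.
- exact: lip.
Qed.

End Score.

(** * Consistency of the statistic *)

Section Cube.
Context {R : realType} {d : nat}.

Lemma measurable_obs_cube : measurable (@obs_cube R d).
Proof.
have -> : @obs_cube R d = (@obsX R d @^-1` `[0, 1] `&` @obsY R d @^-1` `[0, 1])
    `&` \bigcap_(i in [set: 'I_d])
      ((fun w : obs R d => tnth (obsZ w) i) @^-1` `[0, 1]).
  apply/seteqP; split => [w [Xw Yw Zw]|w [[Xw Yw] Zw]].
    by split=> // i _; exact: Zw.
  by split=> // i; exact: Zw.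
apply: measurableI; first apply: measurableI.
- rewrite -[X in measurable X]setTI.
  by apply: measurable_obsX => //; exact: measurable_itv.
- rewrite -[X in measurable X]setTI.
  by apply: measurable_obsY => //; exact: measurable_itv.
apply: fin_bigcap_measurable => // i _.
rewrite -[X in measurable X]setTI.
suff: measurable_fun setT (fun w : obs R d => tnth (obsZ w) i).
  by apply => //; exact: measurable_itv.
exact: measurableT_comp (measurable_tnth i) measurable_obsZ.
Qed.

(** The regularity of the fitted functions is only available for samples in the
    cube.  The exceptional event, a countable union of null events, does not
    depend on the sample size. *)
Lemma asymp_null_obs_cube (dO : measure_display) (Omega : measurableType dO)
    (Q : probability Omega R) (P : probability (obs R d) R)
    (W : nat -> {mfun Omega >-> obs R d}) :
  iid_from Q P W -> P obs_cube = 1%E ->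
  asymp_null Q (fun=> [set w | exists i, ~ obs_cube (W i w)]).
Proof.
move=> [law _] Pcube.
have -> : [set w | exists i, ~ obs_cube (W i w)] =
    \bigcup_i (W i @^-1` (~` obs_cube)).
  by apply/seteqP; split => w [i]; [exists i|move=> _ ?; exists i].
have mC : measurable (~` @obs_cube R d).
  by apply: measurableC; exact: measurable_obs_cube.
have mWi i : measurable (W i @^-1` (~` @obs_cube R d)).
  by rewrite -[X in measurable X]setTI; exact: measurable_funPT.
apply: (@asymp_null_measurable _ _ _ _ _ 0) => [n|n _].
  exact: bigcup_measurable.
rewrite mul0r.
have /negligibleP -> // :
    Q.-negligible (\bigcup_i (W i @^-1` (~` @obs_cube R d))).
  apply: negligible_bigcup => i; apply/negligibleP => //.
  have := law i _ mC; rewrite /distribution/= /pushforward => ->.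
  by rewrite probability_setC ?Pcube ?subee//; exact: measurable_obs_cube.
exact: bigcup_measurable.
Qed.

End Cube.

(** The sup norm is taken over the quantile range only, yet after clamping it
    bounds the error of the estimator on all of [0, 1]. *)
Lemma clamped_cdf_close (R : realType) (d q : nat) (phi : R -> 'cV[R]_q)
    (k : R.-pker (d.-tuple R) ~> R) (G : R -> d.-tuple R -> R) (del : R)
    (z : d.-tuple R) (t : R) :
  score phi -> k z `[0, 1]%classic = 1%E -> continuous (cond_cdf k ^~ z) ->
  cube z -> {in `[0, 1] &, {homo G ^~ z : s t / s <= t}} ->
  (supnorm_in phi k (fun t z => cond_cdf k t z - G t z)%R <= del%:E)%E ->
  t \in `[0, 1] ->
  `|clamp (tau_min phi) (tau_max phi) (cond_cdf k t z) -
    clamp (tau_min phi) (tau_max phi) (G t z)| <= del.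
Proof.
move=> hphi k01 kc cz homG supG t01.
have [lo0 lohi hi1] := tau_range hphi.
have lo01 : tau_min phi \in `[0, 1] by rewrite in_itv/= lo0 (le_trans lohi).
have hi01 : tau_max phi \in `[0, 1] by rewrite in_itv/= hi1 (le_trans lo0).
have [a01 Fa] := cond_cdf_quantile k01 kc lo01.
have [b01 Fb] := cond_cdf_quantile k01 kc hi01.
apply: (@clamp_close _ _ _ _ _ (cond_cdf k ^~ z) (G ^~ z) _ a01 b01 lohi Fa
  Fb) => //.
- by apply: cond_quantile_le; rewrite ?Fb.
- by move=> u v _ _; exact: cond_cdf_nondecreasing.
move=> u uab; rewrite -lee_fin; apply: le_trans supG.
apply: (@le_trans _ _ (ereal_sup [set `|cond_cdf k u z - G u z|%:E |
    u in quantile_range phi k z])).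
  by apply: ereal_sup_ubound; exists u.
by apply: ereal_sup_ubound; exists z.
Qed.

Lemma dist_prod_le (R : realType) (a b a' b' A B ea eb : R) :
  `|a'| <= A -> `|b| <= B -> `|a - a'| <= ea -> `|b - b'| <= eb ->
  `|a * b - a' * b'| <= ea * B + A * eb.
Proof.
move=> aA bB aa bb.
have -> : a * b - a' * b' = (a - a') * b + a' * (b - b') by ring.
by rewrite (le_trans (ler_normD _ _))// !normrM lerD// ler_pM.
Qed.

Section Entries.
Context {R : realType} {d q : nat} {dO : measure_display}
  {Omega : measurableType dO}.

Lemma fitted_homo_itv (V : obs R d -> R) (Fhat : cdf_estimator R d)
    (W : nat -> Omega -> obs R d) (n : nat) (w : Omega) :
  cdf_estimator_ok Fhat -> (0 < n)%N ->
  (forall i, V (W i w) \in `[0, 1] /\ cube (obsZ (W i w))) ->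
  forall z, cube z ->
  {in `[0, 1] &, {homo fitted W V Fhat n w ^~ z : s t / s <= t}} /\
  {in `[0, 1], forall t, fitted W V Fhat n w t z \in `[0, 1]}.
Proof.
move=> okF n0 W01 z cz.
have Wok (i : 'I_n) : (tnth (sample W V n w) i).1 \in `[0, 1] /\
    cube (tnth (sample W V n w) i).2 by rewrite tnth_mktuple; exact: W01.
have [_ homF F0 F1] := okF n (sample W V n w) n0 Wok z cz.
split=> // t t01; move: (t01); rewrite !in_itv/= => /andP[t0 t1].
rewrite -{1}F0 -F1; apply/andP; split; apply: homF => //.
  by rewrite in_itv/= lexx ler01.
by rewrite in_itv/= lexx ler01.
Qed.

(** Off the exceptional events, each summand of the statistic differs from the
    oracle summand by at most [(L1 * B2 + B1 * L2) * del], where [L1], [L2] are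
    Lipschitz constants and [B1], [B2] bounds of the two scores. *)
Lemma rho_hat_entry_cvg (phi : R -> 'cV[R]_q) (FhatX FhatY : cdf_estimator R d)
    (P : probability (obs R d) R) (kX kY : R.-pker (d.-tuple R) ~> R)
    (Q : probability Omega R) (W : nat -> {mfun Omega >-> obs R d})
    (k l : 'I_q) (e : R) :
  score phi -> cdf_estimator_ok FhatX -> cdf_estimator_ok FhatY ->
  P obs_cube = 1%E ->
  (forall z, cube z -> kX z `[0, 1]%classic = 1%E) -> continuous_cond kX ->
  (forall z, cube z -> kY z `[0, 1]%classic = 1%E) -> continuous_cond kY ->
  iid_from Q P W ->
  (forall del, 0 < del -> asymp_null Q (fun n => [set w |
    (del%:E < supnorm_in phi kX (fun t z =>
      cond_cdf kX t z - fitted W obsX FhatX n w t z)%R)%E])) ->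
  (forall del, 0 < del -> asymp_null Q (fun n => [set w |
    (del%:E < supnorm_in phi kY (fun t z =>
      cond_cdf kY t z - fitted W obsY FhatY n w t z)%R)%E])) ->
  0 < e ->
  asymp_null Q (fun n => [set w |
    e < `|rho_hat W phi FhatX FhatY n w k l - rho phi P kX kY k l|]).
Proof.
move=> hphi okX okY Pcube kX01 kXc kY01 kYc iid nullX nullY e0.
have [f [L1 [B1 [L10 B10 fE fB fL]]]] := score_extension hphi k.
have [g [L2 [B2 [L20 B20 gE gB gL]]]] := score_extension hphi l.
have clamp_lip (h : R -> R) L : 0 <= L -> (forall u v, `|h u - h v| <=
    L * `|clamp (tau_min phi) (tau_max phi) u -
          clamp (tau_min phi) (tau_max phi) v|) -> measurable_fun setT h.
  move=> L0 hL; apply: (lipschitz_measurable L0) => u v.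
  exact: le_trans (hL u v) (ler_wpM2l L0 (clamp_lipschitz _ _ _ _)).
pose psi w := f (U_true obsX kX w) * g (U_true obsY kY w).
have mpsi : measurable_fun setT psi.
  apply: measurable_funM; apply: measurableT_comp.
  - exact: clamp_lip fL.
  - exact: measurable_U_true measurable_obsX.
  - exact: clamp_lip gL.
  - exact: measurable_U_true measurable_obsY.
have psiB x : `|psi x| <= B1 * B2 by rewrite normrM ler_pM.
have U01 (kk : R.-pker (d.-tuple R) ~> R) V x : U_true V kk x \in `[0, 1].
  by rewrite in_itv/= cond_cdf_ge0 cond_cdf_le1.
have rhoE : rho phi P kX kY k l = fine 'E_P[psi].
  rewrite mxE; congr (fine (expectation _ _)); apply/funext => x.
  by rewrite !mxE big_ord1 !mxE /psi fE// gE.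
(* [K * del] bounds the error of one summand; adding 1 avoids dividing by 0. *)
pose K := L1 * B2 + B1 * L2.
have K0 : 0 <= K by rewrite addr_ge0// mulr_ge0.
pose del := e / 2 / (K + 1).
have K1 : 0 < K + 1 by rewrite ltr_wpDl.
have del0 : 0 < del by rewrite !divr_gt0.
have Kdel : K * del <= e / 2.
  by rewrite mulrCA ler_piMr ?divr_ge0 ?(ltW e0)// ler_pdivrMr// mul1r lerDl.
have e20 : 0 < e / 2 by rewrite divr_gt0.
apply: asymp_null_sub _ (asymp_nullU (asymp_null_obs_cube iid Pcube)
  (asymp_nullU (nullX del del0) (asymp_nullU (nullY del del0)
    (weak_law iid mpsi psiB e20)))).
exists 1%N => // n /= n0 w /= dev.
have [Wcube|/existsNP[i Wi]] := pselect (forall i, obs_cube (W i w));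
  last by left; exists i.
right.
have [supX|] := leP (supnorm_in phi kX (fun t z =>
      cond_cdf kX t z - fitted W obsX FhatX n w t z)%R) del%:E; last by left.
right.
have [supY|] := leP (supnorm_in phi kY (fun t z =>
      cond_cdf kY t z - fitted W obsY FhatY n w t z)%R) del%:E; last by left.
right; rewrite ltNge; apply/negP => lln; move: dev; apply/negP; rewrite -leNgt.
have WX i : obsX (W i w) \in `[0, 1] /\ cube (obsZ (W i w)).
  by have [] := Wcube i.
have WY i : obsY (W i w) \in `[0, 1] /\ cube (obsZ (W i w)).
  by have [] := Wcube i.
have fitX := @fitted_homo_itv obsX FhatX W n w okX n0 WX.
have fitY := @fitted_homo_itv obsY FhatY W n w okY n0 WY.
have closeX i : `|f (U_hat W obsX FhatX n i w) - f (U_true obsX kX (W i w))|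
    <= L1 * del.
  have [Xi Zi] := WX i; have [hom _] := fitX _ Zi.
  rewrite distrC (le_trans (fL _ _))// ler_wpM2l//.
  exact: (clamped_cdf_close hphi (kX01 _ Zi) (kXc _ Zi) Zi hom supX Xi).
have closeY i : `|g (U_hat W obsY FhatY n i w) - g (U_true obsY kY (W i w))|
    <= L2 * del.
  have [Yi Zi] := WY i; have [hom _] := fitY _ Zi.
  rewrite distrC (le_trans (gL _ _))// ler_wpM2l//.
  exact: (clamped_cdf_close hphi (kY01 _ Zi) (kYc _ Zi) Zi hom supY Yi).
pose psih i := f (U_hat W obsX FhatX n i w) * g (U_hat W obsY FhatY n i w).
have hatE : rho_hat W phi FhatX FhatY n w k l = n%:R^-1 * \sum_(i < n) psih i.
  rewrite !mxE summxE; congr (_ * _); apply: eq_bigr => i _.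
  rewrite !mxE big_ord1 !mxE fE ?gE//.
  - by have [Yi Zi] := WY i; exact: (fitY _ Zi).2.
  - by have [Xi Zi] := WX i; exact: (fitX _ Zi).2.
have nR0 : 0 < n%:R :> R by rewrite ltr0n.
have diff : `|n%:R^-1 * (\sum_(i < n) psih i) -
    n%:R^-1 * \sum_(i < n) psi (W i w)| <= e / 2.
  apply: le_trans Kdel.
  rewrite -mulrBr -sumrB normrM gtr0_norm ?invr_gt0// mulrC ler_pdivrMr//.
  apply: (le_trans (ler_norm_sum _ _ _)).
  have -> : K * del * n%:R = \sum_(i < n) K * del.
    by rewrite sumr_const card_ord mulr_natr.
  apply: ler_sum => i _; rewrite /psih /psi.
  have -> : K * del = L1 * del * B2 + B1 * (L2 * del) by rewrite /K; ring.
  by apply: dist_prod_le.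
rewrite hatE rhoE; apply: (le_trans (ler_distD (n%:R^-1 *
  \sum_(i < n) psi (W i w)) _ _)).
by rewrite [e]splitr lerD.
Qed.

End Entries.

Lemma mx_norm_gt_entry (R : realType) (m n : nat) (A : 'M[R]_(m, n)) (e : R) :
  0 < e -> e < `|A| -> exists ij : 'I_m * 'I_n, e < `|A ij.1 ij.2|.
Proof.
move=> e0 eA.
have A0 : mx_norm A != 0 by rewrite gt_eqF// (lt_trans e0).
by have [ij Aij] := mx_norm_neq0 A0; exists ij; rewrite -Aij.
Qed.

Theorem theorem18 (R : realType) (d q : nat)
  (phi : R -> 'cV[R]_q) (hphi : score phi)
  (FhatX FhatY : cdf_estimator R d)
  (hFhatX : cdf_estimator_ok FhatX) (hFhatY : cdf_estimator_ok FhatY)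
  (P0 : set (probability (obs R d) R)) (hP0 : P0 `<=` @calP R d)
  (kX kY : probability (obs R d) R -> R.-pker (d.-tuple R) ~> R)
  (hkX : forall P, P0 P -> cond_dist P obsX (kX P) /\ continuous_cond (kX P))
  (hkY : forall P, P0 P -> cond_dist P obsY (kY P) /\ continuous_cond (kY P))
  (dO : measure_display) (Omega : measurableType dO)
  (Pr : probability (obs R d) R -> probability Omega R)
  (W : nat -> {mfun Omega >-> obs R d})
  (hW : forall P, P0 P -> iid_from (Pr P) P W)
  (hrates : forall P, P0 P ->
    exists g h : nat -> R, exists xi xi' : R -> d.-tuple R -> R,
    [/\ rate g /\ rate h,
        bigO_P (Pr P) (fun n w => supnorm_in phi (kX P)
          (fun t z => cond_cdf (kX P) t z - fitted W obsX FhatX n w t z)) g /\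
        bigO_P (Pr P) (fun n w => supnorm_in phi (kY P)
          (fun t z => cond_cdf (kY P) t z - fitted W obsY FhatY n w t z)) h &
        bigO_P (Pr P) (fun n w => supnorm_out phi (kX P)
          (fun t z => xi t z - fitted W obsX FhatX n w t z)) g /\
        bigO_P (Pr P) (fun n w => supnorm_out phi (kY P)
          (fun t z => xi' t z - fitted W obsY FhatY n w t z)) h]) :
  forall P, P0 P ->
    cvg_in_prob (Pr P) (rho_hat W phi FhatX FhatY) (rho phi P (kX P) (kY P)).
Proof.
move=> P P0P e e0.
have [g [h [xi [xi' [[rg rh] [Og Oh] _]]]]] := hrates P P0P.
have [[_ kX01] kXc] := hkX P P0P; have [[_ kY01] kYc] := hkY P P0P.
have [Pcube _] := hP0 P P0P.
have entry (kl : 'I_q * 'I_q) := @rho_hat_entry_cvg R d q dO Omega phi FhatX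
  FhatY P (kX P) (kY P) (Pr P) W kl.1 kl.2 e hphi hFhatX hFhatY Pcube
  kX01 kXc kY01 kYc (hW P P0P)
  (fun del => @bigO_asymp_null _ _ _ _ _ _ del Og rg)
  (fun del => @bigO_asymp_null _ _ _ _ _ _ del Oh rh) e0.
apply: asymp_null_sub _ (asymp_null_exists entry).
apply: nearW => n w /= /(mx_norm_gt_entry e0) [kl].
by rewrite !mxE; exists kl; rewrite !mxE.
Qed.
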